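(* Let $S$ be a finite nonabelian simple group. A subgroup $H$ of $S$ is epimorphically embedded in $S$ (in the variety $\mathrm{Var}(S)$) if and only if $$\{\psi\in\mathrm{Aut}(S)\mid \psi(h)=h \text{ for all } h\in H\}=\{\mathrm{id}_S\}.$$ In particular, if all automorphisms of $S$ are inner and $H$ is a maximal subgroup of $S$, then $H$ is epimorphically embedded in $S$ (in $\mathrm{Var}(S)$) if and only if $Z(H)=\{e\}$.
   Context: A variety of groups is a class of groups (regarded as a full subcategory of the category of all groups) closed under taking quotients, subgroups and arbitrary direct products. $\mathrm{Var}(S)$ denotes the variety generated by $S$, i.e. the smallest variety containing $S$. A subgroup $H$ of a group $G\in\mathcal{V}$ is epimorphically embedded in $G$ (in the variety $\mathcal{V}$) if the inclusion $H\hookrightarrow G$ is an epimorphism in $\mathcal{V}$, i.e. for every $C\in\mathcal{V}$ and all homomorphisms $f,g\colon G\to C$, $f|_H=g|_H$ implies $f=g$. $Z(H)$ denotes the center of $H$, and $e$ the identity element. *)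

(* Defs.v *)
From HB Require Import structures.
From mathcomp Require Import all_boot all_fingroup all_solvable.
From mathcomp Require Import boolp.

Set Implicit Arguments.
Unset Strict Implicit.
Unset Printing Implicit Defensive.

Local Open Scope group_scope.

(* Groups, finite or not, are elements of [groupType]; the [choiceType]
   structure this requires is no restriction, since [boolp] provides one on
   every type. A {multiplicative G -> K} between groups is a homomorphism. *)

Definition prodg (I : Type) (G : I -> groupType) : Type := forall i, G i.

Section ProdGroup.
Variables (I : Type) (G : I -> groupType).
Implicit Types x y z : prodg G.

HB.instance Definition _ := gen_eqMixin (prodg G).
HB.instance Definition _ := gen_choiceMixin (prodg G).

Definition prodg_mul x y : prodg G := fun i => x i * y i.
Definition prodg_one : prodg G := fun i => 1.
Definition prodg_inv x : prodg G := fun i => (x i)^-1.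

Lemma prodg_mulA : associative prodg_mul.
Proof. by move=> x y z; apply: functional_extensionality_dep => i; apply: mulgA. Qed.
Lemma prodg_mul1 : left_id prodg_one prodg_mul.
Proof. by move=> x; apply: functional_extensionality_dep => i; apply: mul1g. Qed.
Lemma prodg_mulr1 : right_id prodg_one prodg_mul.
Proof. by move=> x; apply: functional_extensionality_dep => i; apply: mulg1. Qed.
Lemma prodg_mulV : left_inverse prodg_one prodg_inv prodg_mul.
Proof. by move=> x; apply: functional_extensionality_dep => i; apply: mulVg. Qed.
Lemma prodg_mulrV : right_inverse prodg_one prodg_inv prodg_mul.
Proof. by move=> x; apply: functional_extensionality_dep => i; apply: mulgV. Qed.

HB.instance Definition _ := isGroup.Build (prodg G)
  prodg_mulA prodg_mul1 prodg_mulr1 prodg_mulV prodg_mulrV.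

End ProdGroup.

(* Quotients are given as surjective images and subgroups as injective
   homomorphisms, so a variety is closed under isomorphism. *)
Record is_variety (V : groupType -> Prop) : Prop := IsVariety {
  variety_quo : forall (G Q : groupType) (f : {multiplicative G -> Q}),
    (forall y, exists x, f x = y) -> V G -> V Q;
  variety_sub : forall (G K : groupType) (f : {multiplicative K -> G}),
    injective f -> V G -> V K;
  variety_prod : forall (I : Type) (G : I -> groupType),
    (forall i, V (G i)) -> V (prodg G)
}.

Definition Var (S : groupType) : groupType -> Prop :=
  fun G => forall V : groupType -> Prop, is_variety V -> V S -> V G.

Lemma Var_gen (S : groupType) : Var S S.
Proof. by move=> V _. Qed.

Lemma Var_is_variety (S : groupType) : is_variety (Var S).
Proof.
split=> [G Q f f_surj VG V Vvar VS|G K f f_inj VG V Vvar VS|I G VG V Vvar VS].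
- by apply: (variety_quo Vvar f_surj); apply: VG.
- by apply: (variety_sub Vvar f_inj); apply: VG.
- by apply: (variety_prod Vvar) => i; apply: VG.
Qed.

(* Meant for G in V and H a subgroup of G. *)
Definition epi_embedded (V : groupType -> Prop) (G : groupType)
    (H : {pred G}) : Prop :=
  forall C : groupType, V C -> forall f g : {multiplicative G -> C},
    {in H, f =1 g} -> f =1 g.
Arguments epi_embedded V G H : clear implicits.

(* Main.v *)
(** Epimorphisms into a finite simple group [S] in [Var S]: two homomorphisms
    [f, g : S -> C] involve finitely many elements of [C], and words in these
    elements identify the group they generate with a quotient [D / N] of a
    subgroup [D] of a finite power of [S].  Since [S] is simple and perfect, [f s]
    has a representative in [D] that is trivial in every coordinate that does
    not factor through [D / N]; likewise for [g s].  On a coordinate that factors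
    through [D / N], [f] and [g] induce endomorphisms of [S] that agree on [H],
    and these coincide as soon as only the identity automorphism fixes [H]
    pointwise.  Hence the two representatives are equal, and so are [f s] and
    [g s]. *)
Require Import Defs.
From HB Require Import structures.
From mathcomp Require Import all_boot all_fingroup all_solvable.
From mathcomp Require Import boolp.

Local Open Scope group_scope.

(** * Words and laws of a variety *)

Inductive word (X : Type) : Type :=
| WVar of X
| WOne
| WMul of word X & word X
| WInv of word X.

Arguments WOne {X}.

Fixpoint word_eval (X : Type) (G : groupType) (c : X -> G) (w : word X) : G :=
  match w with
  | WVar x => c x
  | WOne => 1
  | WMul u v => word_eval X G c u * word_eval X G c v
  | WInv u => (word_eval X G c u)^-1
  end.
Arguments word_eval {X G} c w.

Lemma multiplicative1 (G K : groupType) (f : {multiplicative G -> K}) : f 1 = 1.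
Proof. by apply: (mulgI (f 1)); rewrite -gmulfM !mulg1. Qed.

Lemma multiplicativeV (G K : groupType) (f : {multiplicative G -> K}) (x : G) :
  f x^-1 = (f x)^-1.
Proof. by apply: (mulgI (f x)); rewrite -gmulfM !mulgV multiplicative1. Qed.

Lemma word_eval_morph (X : Type) (G K : groupType) (f : {multiplicative G -> K})
    (c : X -> G) (w : word X) :
  f (word_eval c w) = word_eval (f \o c) w.
Proof.
elim: w => [x||u IHu v IHv|u IHu] //=; first exact: multiplicative1.
- by rewrite gmulfM IHu IHv.
- by rewrite multiplicativeV IHu.
Qed.

Lemma word_eval_prodg (X I : Type) (G : I -> groupType) (c : X -> prodg G)
    (w : word X) (i : I) :
  (word_eval c w : prodg G) i = word_eval (fun x => c x i) w.
Proof.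
elim: w => [x||u IHu v IHv|u IHu] //=.
- by rewrite -IHu -IHv.
- by rewrite -IHu.
Qed.

Definition satisfies_laws (X : Type) (S C : groupType) : Prop :=
  forall w : word X, (forall a : X -> S, word_eval a w = 1) ->
  forall c : X -> C, word_eval c w = 1.

Lemma satisfies_laws_is_variety (X : Type) (S : groupType) :
  is_variety (satisfies_laws X S).
Proof.
split=> [G Q f f_surj VG|G K f f_inj VG|I G VG] w w1 c.
- have [h hP] := choice f_surj.
  have -> : c = f \o (h \o c) by apply: funext => x /=; rewrite hP.
  by rewrite -word_eval_morph VG // multiplicative1.
- by apply: f_inj; rewrite word_eval_morph VG // multiplicative1.
- apply: functional_extensionality_dep => i.
  by rewrite word_eval_prodg (VG i w w1).
Qed.

(** The easy half of Birkhoff's theorem: the groups satisfying the laws of [S] form a variety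
    containing [S]. *)
Lemma Var_satisfies_laws (X : Type) (S C : groupType) :
  Var S C -> satisfies_laws X S C.
Proof. by move=> VarC; apply: VarC (satisfies_laws_is_variety X S) _ => w. Qed.

(** * Finitely generated subgroups of [C] as subquotients of a finite power of [S] *)

Section Relators.
Variables (X : finType) (S : finGroupType) (C : groupType) (c : X -> C).
Hypothesis lawsC : satisfies_laws X S C.

(* [powS] is the power of [S] over all assignments [X -> S], in which the
   elements [gen x] freely generate the relatively free group of [Var S]. *)
Local Notation powS := {dffun forall a : {ffun X -> S}, (fun=> S) a}.

Definition gen (x : X) : powS := [ffun a : {ffun X -> S} => a x].

Definition coord (a : {ffun X -> S}) (d : powS) : S := d a.

Lemma coordM (a : {ffun X -> S}) : {in [set: powS] &, {morph coord a : d e / d * e}}.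
Proof. by move=> d e _ _; rewrite /coord ffunE. Qed.

Canonical coord_morphism (a : {ffun X -> S}) := Morphism (coordM a).

Lemma word_eval_gen (w : word X) (a : {ffun X -> S}) :
  coord a (word_eval gen w) = word_eval a w.
Proof.
elim: w => [x||u IHu v IHv|u IHu] /=.
- by rewrite /coord ffunE.
- by rewrite morph1.
- by rewrite morphM ?inE //= IHu IHv.
- by rewrite morphV ?inE //= IHu.
Qed.

(** The coordinates of [powS] run over all assignments, so the hypothesis makes [u v^-1] a law of
    [S], hence of [C]. *)
Lemma word_eval_transfer (u v : word X) :
  word_eval gen u = word_eval gen v -> word_eval c u = word_eval c v.
Proof.
move=> uv; apply/divg1_eq; apply: (lawsC (WMul _ u (WInv _ v))) => a /=.
have aE : a = finfun a :> (X -> S) by apply: funext => x; rewrite ffunE.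
by rewrite aE -!word_eval_gen uv mulgV.
Qed.

(** The kernel of the homomorphism sending each [gen x] to [c x], described by words because [C] may
    be infinite. *)
Definition relators : {set powS} :=
  [set d | `[< exists2 w, d = word_eval gen w & word_eval c w = 1 >]].

Lemma relatorsP (w : word X) : (word_eval gen w \in relators) <-> word_eval c w = 1.
Proof.
rewrite inE; split=> [/asboolP[u /word_eval_transfer -> //] | w1].
by apply/asboolP; exists w.
Qed.

Lemma relators_group_set : group_set relators.
Proof.
apply/group_setP; split=> [|d e]; first by apply/(relatorsP WOne).
rewrite inE => /asboolP[u -> u1]; rewrite inE => /asboolP[v -> v1].
by apply/(relatorsP (WMul _ u v)); rewrite /= u1 v1 mulg1.
Qed.

Canonical relators_group := Group relators_group_set.

(** A word conjugated by a generator is again a word. Since [coset] is 1 off the normaliser, the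
    cosets of generators carry information only through this fact. *)
Lemma gen_norm (x : X) : gen x \in 'N(relators).
Proof.
rewrite inE; apply/subsetP => _ /imsetP[d + ->].
rewrite inE => /asboolP[w -> w1].
apply/(relatorsP (WMul _ (WInv _ (WVar _ x)) (WMul _ w (WVar _ x)))).
by rewrite /= w1 mul1g mulVg.
Qed.

Lemma coset_gen_eq (x y : X) :
  coset relators (gen x) = coset relators (gen y) <-> c x = c y.
Proof.
have E : gen x * (gen y)^-1 \in relators <-> c x = c y.
  rewrite (relatorsP (WMul _ (WVar _ x) (WInv _ (WVar _ y)))) /=.
  by split=> [/divg1_eq | ->]; rewrite ?mulgV.
rewrite -E -mem_rcoset; split=> [|xy]; first by move/rcoset_kercosetP; apply; apply: gen_norm.
by apply/rcoset_kercosetP; rewrite ?gen_norm.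
Qed.

Lemma coset_gen_mul (x y z : X) :
  c z = c x * c y ->
  coset relators (gen z) = coset relators (gen x) * coset relators (gen y).
Proof.
move=> zxy; rewrite -morphM ?gen_norm //.
apply/rcoset_kercosetP; rewrite ?groupM ?gen_norm // mem_rcoset.
apply/(relatorsP (WMul _ (WVar _ z) (WInv _ (WMul _ (WVar _ x) (WVar _ y))))).
by rewrite /= zxy mulgV.
Qed.

End Relators.

(** * Lifting a simple group through a quotient *)

Lemma simple_nonabelian_perfect (gT : finGroupType) (G : {group gT}) :
  simple G -> ~~ abelian G -> [~: G, G] = G.
Proof.
move=> /simpleP[_ simG] nabG.
case: (simG [~: G, G]%G (der_normal 1 G)) => //= G'1.
by case/negP: nabG; apply/commG1P.
Qed.

Lemma simple_ker (gT rT : finGroupType) (G : {group gT})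
    (f : {morphism G >-> rT}) :
  simple G -> 'ker f = 1 \/ 'ker f = G.
Proof.
by move=> /simpleP[_ /(_ _ (ker_normal f))].
Qed.

(* A perfect quotient that is covered by both [K] and [L] is covered by
   [[K, L]], hence by the intersection. *)
Lemma perfect_quotientI (gT : finGroupType) (N E K L : {group gT}) :
  E \subset 'N(N) -> [~: E / N, E / N] = E / N -> K <| E -> L <| E ->
  K / N = E / N -> L / N = E / N -> (K :&: L) / N = E / N.
Proof.
move=> nNE perfE /andP[sKE nKE] /andP[sLE nLE] KE LE.
apply/eqP; rewrite eqEsubset quotientS ?subIset ?sKE //=.
rewrite -perfE -{1}KE -{1}LE -quotientR ?(subset_trans sKE) ?(subset_trans sLE) //.
apply: quotientS; rewrite subsetI commg_subl commg_subr.
by rewrite (subset_trans sLE) ?(subset_trans sKE).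
Qed.

(** Let [E] be the preimage of the image of [f]. For each coordinate whose kernel does not contain
    [N], that kernel meets [E] in a subgroup still covering [E / N]; perfectness lets all these
    subgroups be intersected. *)
Lemma simple_lift (gT pT : finGroupType) (I : finType)
    (p : I -> {morphism [set: pT] >-> gT}) (N : {group pT})
    (f : {morphism [set: gT] >-> coset_of N}) (s : gT) :
  simple [set: gT] -> ~~ abelian [set: gT] ->
  exists a : pT, [/\ a \in 'N(N), coset N a = f s &
    forall i, ~~ (N \subset 'ker (p i)) -> p i a = 1].
Proof.
move=> simS nabS; case: (simple_ker _ _ _ f simS) => kerf; last first.
  exists 1; split=> [||i _]; rewrite ?group1 ?morph1 //.
  by rewrite (@mker _ _ _ f s) // kerf inE.
set A := (f @* [set: gT])%G; set E := (coset N @*^-1 A)%G.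
have injf : 'injm f by rewrite kerf.
have isoA : [set: gT]%G \isog A by apply: sub_isog.
have simA : simple A by rewrite -(isog_simple isoA).
have nabA : ~~ abelian A by rewrite -(isog_abelian isoA).
have nNE : E \subset 'N(N) by apply: subsetIl.
have EN : E / N = A by apply: cosetpreK.
have perfE : [~: E / N, E / N] = E / N.
  by rewrite EN; apply: simple_nonabelian_perfect.
pose K i := (E :&: 'ker (p i))%G.
have normK i : K i <| E.
  by rewrite /normal subsetIl normsI ?normG // (subset_trans (subsetT _)) ?ker_norm.
have coverK i : ~~ (N \subset 'ker (p i)) -> K i / N = E / N.
  move=> nsN; have /simpleP[_ simAP] := simA.
  have nKA : K i / N <| A by rewrite -EN quotient_normal.
  case: (simAP (K i / N)%G nKA) => KA; last by rewrite EN.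
  case/negP: nsN; have sKN : K i \subset N.
    by rewrite -quotient_sub1 ?KA // (subset_trans (subsetIl _ _)).
  (* The index of [K i] in [E] is at most the order of [gT], which is the index of [N]; so [K i]
     inside [N] forces equality, and [N] would lie in the kernel. *)
  have oE : #|E| = (#|N| * #|[set: gT]|)%N.
    by rewrite card_cosetpre (card_isog isoA).
  have oK : (#|p i @* E| * #|K i| = #|E|)%N.
    rewrite card_morphim setTI -indexgI mulnC Lagrange ?subsetIl //.
  suff /eqP <- : K i :==: N by apply: subsetIr.
  rewrite eqEcard sKN -(@leq_pmul2r #|[set: gT]|) ?cardG_gt0 //.
  by rewrite -oE -oK mulnC leq_mul2l subset_leq_card ?subsetT ?orbT.
have cover (r : seq I) : exists L : {group pT}, [/\ L <| E, L / N = E / N &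
    {in r, forall i, ~~ (N \subset 'ker (p i)) -> L \subset 'ker (p i)}].
  elim: r => [|i r [L [nL LE kerL]]]; first by exists E; rewrite normal_refl.
  have [sNK | nsNK] := boolP (N \subset 'ker (p i)).
    exists L; split=> // j; rewrite inE => /predU1P[-> /negP[] // | rj nsN].
    exact: kerL.
  exists (K i :&: L)%G; split.
  - have /andP[sKE nKE] := normK i.
    by rewrite /normal subIset ?sKE // normsI // normal_norm.
  - by apply: (perfect_quotientI _ N E (K i) L) => //; apply: coverK.
  - move=> j; rewrite inE => /predU1P[-> _ | rj nsN].
      by rewrite subIset // subsetIr.
    by rewrite subIset // kerL ?orbT.
have [L [_ coverL kerL]] := cover (enum I).
have : f s \in E / N by rewrite EN mem_morphim ?inE.
rewrite -coverL => /morphimP[a nNa La fsa].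
exists a; split=> // i nsN; apply: mker.
by apply: (subsetP (kerL i _ nsN)); rewrite ?mem_enum.
Qed.

(** * Automorphisms fixing [H] pointwise *)

Lemma fixing_Aut_eq1P (gT : finGroupType) (H : {group gT}) :
  [set psi in Aut [set: gT] | [forall (h | h \in H), psi h == h]]
    = [set 1 : {perm gT}] <->
  (forall psi : {perm gT}, psi \in Aut [set: gT] ->
     {in H, forall h, psi h = h} -> psi = 1).
Proof.
split=> [fixH psi Apsi psiH | fix1].
  apply/set1P; rewrite -fixH inE Apsi /=.
  by apply/forall_inP => h Hh; rewrite psiH.
apply/setP => psi; rewrite [LHS]inE in_set1.
apply/andP/eqP => [[Apsi /forall_inP psiH] | ->].
  by apply: fix1 => // h Hh; apply/eqP/psiH.
by split; [exact: group1 | apply/forall_inP => h _; rewrite perm1].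
Qed.

Section FixingAutomorphisms.
Variables (gT : finGroupType) (H : {group gT}).
Hypotheses (simS : simple [set: gT]) (nabS : ~~ abelian [set: gT]).

Lemma simple_cent1 : 'C([set: gT]) = 1.
Proof.
have CZ : 'C([set: gT]) = 'Z([set: gT]) by rewrite /center setTI.
have /simpleP[_ simP] := simS.
case: (simP 'Z([set: gT])%G (center_normal _)) => /= Z; first by rewrite CZ.
by case/negP: nabS; rewrite /abelian CZ Z.
Qed.

Lemma Aut_conj_set (x : gT) : conj_aut [set: gT] x \in Aut [set: gT].
Proof.
apply: (subsetP (Aut_conj_aut [set: gT]%G 'N([set: gT]))).
by apply: mem_morphim; apply: (subsetP (normG _)); rewrite inE.
Qed.

Hypothesis Aut_fixing_eq1 : forall psi : {perm gT},
  psi \in Aut [set: gT] -> {in H, forall h, psi h = h} -> psi = 1.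

(** Conjugation by an element centralising [H] fixes [H], so it is trivial and the element is
    central. *)
Lemma fixing_cent1 : 'C(H) = 1.
Proof.
suff : 'C(H) \subset 'C([set: gT]) by rewrite simple_cent1 => /trivgP.
apply/subsetP => x /centP cHx; apply/centP => y _.
have conj1 : conj_aut [set: gT] x = 1.
  apply: Aut_fixing_eq1 (Aut_conj_set x) _ => h Hh.
  by rewrite conj_autE ?inE // conjgE -(cHx h Hh) mulKg.
apply: commute_sym; apply/commgP/conjg_fixP.
by rewrite -(conj_autE (in_setT x) (in_setT y)) conj1 perm1.
Qed.

(** An endomorphism of a finite simple group is trivial or bijective. As [H] is nontrivial, [u] and
    [v] are of the same kind; if both are bijective, [u] followed by the inverse of [v] fixes
    [H]. *)
Lemma fixing_hom_eq (u v : {morphism [set: gT] >-> gT}) :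
  {in H, u =1 v} -> u =1 v.
Proof.
move=> uvH s.
have ntH : H :!=: 1.
  apply: contra nabS => /eqP H1.
  by have := fixing_cent1; rewrite H1 cent1T => ->; apply: abelian1.
have kerH (w w' : {morphism [set: gT] >-> gT}) : {in H, w =1 w'} ->
    'ker w = [set: gT] -> 'ker w' = [set: gT].
  move=> ww' kerw; case: (simple_ker _ _ _ w' simS) => // kerw'.
  case/negP: ntH; rewrite -subG1 -kerw'; apply/subsetP => h Hh.
  by apply/kerP; rewrite ?inE // -ww' //; apply: mker; rewrite kerw inE.
have vuH : {in H, v =1 u} by move=> h Hh; rewrite uvH.
case: (simple_ker _ _ _ u simS) => keru; last first.
  by rewrite !mker ?keru ?(kerH u v uvH keru) ?inE.
case: (simple_ker _ _ _ v simS) => kerv; last first.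
  by rewrite !mker ?kerv ?(kerH v u vuH kerv) ?inE.
have imT (w : {morphism [set: gT] >-> gT}) : 'injm w -> w @* [set: gT] = [set: gT].
  by move=> injw; apply/eqP; rewrite eqEcard subsetT card_injm /=.
have inju : 'injm u by rewrite keru.
have injv : 'injm v by rewrite kerv.
pose a := aut inju (imT u inju); pose b := aut injv (imT v injv).
have ab1 : a * b^-1 = 1.
  apply: Aut_fixing_eq1 => [|h Hh]; first by rewrite groupM ?groupV ?Aut_aut.
  by rewrite permM autE ?inE // uvH // -(autE injv (imT v injv)) ?inE // permK.
have -> : u s = a s by rewrite autE ?inE.
have -> : v s = b s by rewrite autE ?inE.
by move/eqP: ab1; rewrite -eq_mulgV1 => /eqP ->.
Qed.

Lemma fixing_hom_quotient_eq (pT : finGroupType) (I : finType)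
    (p : I -> {morphism [set: pT] >-> gT}) (N : {group pT})
    (f g : {morphism [set: gT] >-> coset_of N}) :
  (forall a b, (forall i, p i a = p i b) -> a = b) ->
  {in H, f =1 g} -> f =1 g.
Proof.
move=> p_inj fgH s.
(* When [N] lies in the kernel of [p i], the choice of representative is immaterial, so [q i w] is
   an endomorphism of [gT]. *)
pose q i (w : {morphism [set: gT] >-> coset_of N}) t := p i (repr (w t)).
have qM i w : N \subset 'ker (p i) -> {in [set: gT] &, {morph q i w : x y / x * y}}.
  move=> sNK x y _ _; rewrite /q -morphM ?inE //.
  have nw t := repr_coset_norm (w t).
  have : repr (w (x * y)) \in N :* (repr (w x) * repr (w y)).
    apply/rcoset_kercosetP; rewrite ?groupM //.
    by rewrite [RHS]morphM //= !coset_reprK morphM ?inE.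
  case/rcosetP=> n Nn ->; rewrite [LHS]morphM ?inE //.
  by rewrite /= (mker (subsetP sNK n Nn)) mul1g.
have qE i (w : {morphism [set: gT] >-> coset_of N}) x t : N \subset 'ker (p i) -> x \in 'N(N) -> coset N x = w t ->
    p i x = q i w t.
  move=> sNK Nx xw; have : x \in N :* repr (w t).
    by apply/rcoset_kercosetP; rewrite ?repr_coset_norm ?coset_reprK.
  case/rcosetP=> n Nn ->; rewrite [LHS]morphM ?inE //.
  by rewrite /= (mker (subsetP sNK n Nn)) mul1g.
have [a [Na fa a1]] := simple_lift _ _ _ p N f s simS nabS.
have [b [Nb gb b1]] := simple_lift _ _ _ p N g s simS nabS.
rewrite -fa -gb; congr (coset N _); apply: p_inj => i.
have [sNK | nsNK] := boolP (N \subset 'ker (p i)); last by rewrite a1 ?b1.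
rewrite (qE i f a s) // (qE i g b s) //.
apply: (fixing_hom_eq (Morphism (qM i f sNK)) (Morphism (qM i g sNK))) => h Hh /=.
by rewrite /q fgH.
Qed.

Lemma fixing_epi_embedded : epi_embedded (Var gT) gT (mem H).
Proof.
move=> C /(Var_satisfies_laws (gT * bool)%type) lawsC f g fgH s.
(* Two generators for each group element, one for its image under [f] and one for that under [g];
   [F false] and [F true] then model [f] and [g] in a finite quotient. *)
pose c (x : gT * bool) : C := if x.2 then g x.1 else f x.1.
pose N := relators_group _ _ _ c lawsC.
pose F b t := coset N (gen _ gT (t, b)).
have FM b : {in [set: gT] &, {morph F b : t u / t * u}}.
  move=> t u _ _; apply: (coset_gen_mul _ _ _ c lawsC).
  by case: b; rewrite /c /= gmulfM.
have : F false s = F true s.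
  apply: (fixing_hom_quotient_eq _ _ (coord_morphism _ gT) N
    (Morphism (FM false)) (Morphism (FM true))) => [d e de | h Hh /=].
    by apply/ffunP => a; apply: (de a).
  by apply/(coset_gen_eq _ _ _ c lawsC); rewrite /c /= fgH.
by move/(coset_gen_eq _ _ _ c lawsC).
Qed.

End FixingAutomorphisms.

(** * The converse, and maximal subgroups *)

Lemma epi_embedded_fixing (gT : finGroupType) (H : {group gT}) :
  epi_embedded (Var gT) gT (mem H) ->
  forall psi : {perm gT}, psi \in Aut [set: gT] ->
  {in H, forall h, psi h = h} -> psi = 1.
Proof.
move=> epiH psi Apsi psiH.
have psiM : {morph (psi : gT -> gT) : x y / x * y}.
  by move=> x y; rewrite -(autmE Apsi) morphM ?inE.
pose psih : {multiplicative gT -> gT} :=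
  HB.pack (psi : gT -> gT) (isMultiplicative.Build gT gT (psi : gT -> gT) psiM).
apply/permP => x; rewrite perm1.
(* The test group is [gT] itself, with [psi] compared to the identity. *)
exact: (epiH gT (@Var_gen gT) psih idfun psiH x).
Qed.

(** By maximality, [H] and its centraliser generate [H] or everything. In the first case the
    centraliser is the centre of [H]. In the second [H] is normal, hence trivial, and maximality
    makes the whole group cyclic, which is excluded. *)
Lemma maximal_cent1 (gT : finGroupType) (H : {group gT}) :
  simple [set: gT] -> ~~ abelian [set: gT] -> maximal H [set: gT] ->
  'Z(H) = 1 -> 'C(H) = 1.
Proof.
move=> simS nabS maxH ZH1.
have /maximal_eqP[_ maxHP] : maximal_eq H [set: gT] by rewrite /maximal_eq maxH orbT.
have sHC : H \subset (H <*> 'C(H))%G by apply: joing_subl.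
have sCC : 'C(H) \subset (H <*> 'C(H))%G by apply: joing_subr.
case: (maxHP _ sHC (subsetT _)) => HC.
  by rewrite -ZH1 /center; apply/esym/setIidPr; rewrite HC in sCC.
have nHS : H <| [set: gT].
  by rewrite /normal subsetT -HC join_subG normG cent_sub.
have /simpleP[ntS simP] := simS.
case: (simP H nHS) => HE; last first.
  by have := maxgroupp maxH; rewrite HE properxx.
case/negP: nabS.
have [x _ ntx] := trivgPn _ ntS.
have sHx : H \subset <[x]>%G by rewrite HE sub1G.
case: (maxHP _ sHx (subsetT _)) => [/eqP | <-]; last exact: cycle_abelian.
by rewrite HE cycle_eq1 (negPf ntx).
Qed.



Theorem corollary2p10 (gT : finGroupType) (H : {group gT})
    (simpleS : simple [set: gT]) (nonabelianS : ~~ abelian [set: gT]) :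
  (epi_embedded (Var gT) gT (mem H) <->
     [set psi in Aut [set: gT] | [forall (h | h \in H), psi h == h]]
     = [set 1 : {perm gT}])
  /\
  ((forall psi : {perm gT}, psi \in Aut [set: gT] ->
      exists x : gT, forall y : gT, psi y = y ^ x) ->
   maximal H [set: gT] ->
   (epi_embedded (Var gT) gT (mem H) <-> 'Z(H) = [set 1 : gT])).
Proof.
have epiP : epi_embedded (Var gT) gT (mem H) <->
    forall psi : {perm gT}, psi \in Aut [set: gT] ->
      {in H, forall h, psi h = h} -> psi = 1.
  by split; [apply: epi_embedded_fixing | apply: fixing_epi_embedded].
split=> [|innS maxH]; first by rewrite fixing_Aut_eq1P.
rewrite epiP; split=> [fixH | ZH1 psi Apsi psiH].
  by rewrite /center (fixing_cent1 _ _ simpleS nonabelianS fixH) setIg1.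
have [x psix] := innS psi Apsi.
have : x \in 'C(H).
  apply/centP => h Hh; apply: commute_sym; apply/commgP/conjg_fixP.
  by rewrite -psix psiH.
rewrite (maximal_cent1 _ _ simpleS nonabelianS maxH ZH1) inE => /eqP x1.
by apply/permP => y; rewrite psix x1 conjg1 perm1.
Qed.
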